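(* Let $E$ be a row-finite graph and $K$ a field. For every class $[v]\in X_f$, put $$a_{[v]}=\sum_{u\in\overline{[v]}}u+\sum_{\alpha\in F_E(\overline{[v]})}\alpha\alpha^*.$$ Then $$\mathcal B_0=\{a_{[v]}\ \vert\ [v]\in X_f\}$$ is a basis of the zero component (for the $\mathbb Z$-grading) of the center of $L_K(E)$.
   Context: A directed graph is $E=(E^0,E^1,r,s)$ with vertex set $E^0$, edge set $E^1$ and range and source maps $r,s:E^1\to E^0$; it is row-finite if $s^{-1}(v)$ is finite for all $v\in E^0$. A vertex $v$ is regular if $s^{-1}(v)$ is finite and nonempty. The Leavitt path algebra $L_K(E)$ is the $K$-algebra generated by $E^0\cup E^1\cup\{e^*: e\in E^1\}$ with relations: $vw=\delta_{v,w}v$ for $v,w\in E^0$; $s(e)e=er(e)=e$ and $r(e)e^*=e^*s(e)=e^*$ for $e\in E^1$; $e^*e'=\delta_{e,e'}r(e)$ for $e,e'\in E^1$; and $v=\sum_{s(e)=v}ee^*$ for every regular $v$. For a path $\alpha=e_1\dots e_n$ write $\alpha^*=e_n^*\dots e_1^*$. $L_K(E)$ is $\mathbb Z$-graded, the degree $n$ component being spanned by the $\alpha\beta^*$ with $\alpha,\beta$ paths and $\mathrm{length}(\alpha)-\mathrm{length}(\beta)=n$; the center is a graded subalgebra. Paths are finite composable sequences of edges; vertices are paths of length $0$. Write $v\ge w$ (or $w\le v$) if there is a path from $v$ to $w$, and $T(v)=\{w: v\ge w\}$. A cycle is a path $\mu=e_1\dots e_n$ ($n\ge1$) with $s(\mu)=r(\mu)$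 and $s(e_i)\ne s(e_j)$ for $i\neq j$; $\mu^0$ denotes its set of vertices. An exit of $\mu$ is an edge $e$ with $s(e)=s(e_i)$ and $e\neq e_i$ for some $i$. There is a bifurcation at a vertex if it emits at least two edges. $P_l$ is the set of vertices $v$ such that $T(v)$ contains neither bifurcations nor cycles. $P_c$ is the set of vertices lying in cycles without exits. A cycle $c$ is extreme if it has exits and for every path $\lambda$ starting at a vertex of $c^0$ there is a path $\mu$ with $s(\mu)=r(\lambda)$ and $r(\mu)\in c^0$; $P_{ec}$ is the set of vertices in extreme cycles. Put $P=P_l\cup P_c\cup P_{ec}$. On $E^0$ define $u\sim^1 v$ iff $u=v$, or (i) ($u\le v$ or $v\le u$) and there are no bifurcations at any vertex of $T(u)$ and $T(v)$, or (ii) there are a cycle $c$, a vertex $w\in c^0$, and paths from $w$ to $u$ and from $w$ to $v$. Let $\sim$ be the transitive closure of $\sim^1$, and $[v]\subseteq E^0$ the class of $v$. For $v\in P$ the set $[v]$ is hereditary ($a\in[v]$, $a\geq b$ imply $b\in [v]$). For a hereditary set $H$, $\overline H$ denotes its saturated closure, the smallest set containing $H$ and containing every regular vertex $v$ with $r(s^{-1}(v))\subseteq\overline H$. $F_E(H)$ is the set of paths $e_1\dots e_n$ ($n\ge 1$) with $s(e_1)\notin H$, $r(e_i)\notin H$ for $i<n$, and $r(e_n)\in H$. $P_f$ is the set of $v\in P$ with $\vert\overline{[v]}\vert<\infty$ and $\vert F_E(\overline{[v]})\vert<\infty$. $X=P/\sim$ is the set of classes $[v]$ with $v\in P$; $X_f\subseteq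 X$ is the set of classes all of whose elements in $P$ lie in $P_f$. *)

(* Defs.v *)
From HB Require Import structures.
From mathcomp Require Import all_boot all_order all_algebra.
From mathcomp Require Import generic_quotient.
From mathcomp Require Import finmap.
From mathcomp Require Import boolp classical_sets functions cardinality fsbigop.
From Stdlib Require Import Relation_Operators.

Set Implicit Arguments.
Unset Strict Implicit.
Unset Printing Implicit Defensive.

Import GRing.Theory.

Local Open Scope classical_set_scope.
Local Open Scope ring_scope.

(* In the presence of the classical axioms every type is a choiceType, so that
   this allows arbitrary sets of vertices and of edges. *)
Record digraph := Digraph {
  vertex : choiceType;
  edge : choiceType;
  src : edge -> vertex;
  rng : edge -> vertex }.

Section Graph.
Variable E : digraph.
Implicit Types (u v w : vertex E) (e f : edge E) (H : set (vertex E)).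

Definition emitted v : set (edge E) := [set e | src e = v].

Definition row_finite := forall v, finite_set (emitted v).

Definition regular v := finite_set (emitted v) /\ emitted v !=set0.

Definition bifurcation v := exists e f, [/\ src e = v, src f = v & e <> f].

Fixpoint composable v (s : seq (edge E)) : bool :=
  if s is e :: s' then (src e == v) && composable (rng e) s' else true.

(* The source is recorded separately, so that the paths with an empty list of
   edges are the vertices. *)
Definition gpath := {p : vertex E * seq (edge E) | composable p.1 p.2}.
HB.instance Definition _ := Choice.on gpath.

Definition edges (p : gpath) : seq (edge E) := (val p).2.
Definition psrc (p : gpath) : vertex E := (val p).1.
Definition prng (p : gpath) : vertex E := last (psrc p) (map (@rng E) (edges p)).
Definition plength (p : gpath) : nat := size (edges p).

Definition reaches v w := exists p : gpath, psrc p = v /\ prng p = w.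

Definition tree v : set (vertex E) := [set w | reaches v w].

Definition is_cycle (c : gpath) :=
  [/\ (0 < plength c)%N, psrc c = prng c & uniq (map (@src E) (edges c))].

(* For a cycle, the sources of its edges are all its vertices. *)
Definition cycle_vertices (c : gpath) : set (vertex E) :=
  [set v | exists2 e, e \in edges c & src e = v].

Definition is_exit (c : gpath) f :=
  exists2 e, e \in edges c & src f = src e /\ f <> e.

Definition has_exit (c : gpath) := exists f, is_exit c f.

Definition extreme (c : gpath) :=
  [/\ is_cycle c, has_exit c &
      forall l : gpath, cycle_vertices c (psrc l) ->
        exists m : gpath, psrc m = prng l /\ cycle_vertices c (prng m)].

Definition P_l : set (vertex E) :=
  [set v | (forall w, tree v w -> ~ bifurcation w) /\
           ~ (exists c, is_cycle c /\ cycle_vertices c `<=` tree v)].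

Definition P_c : set (vertex E) :=
  [set v | exists c, [/\ is_cycle c, ~ has_exit c & cycle_vertices c v]].

Definition P_ec : set (vertex E) :=
  [set v | exists2 c, extreme c & cycle_vertices c v].

Definition P : set (vertex E) := P_l `|` P_c `|` P_ec.

Definition sim1 u v :=
  [\/ u = v,
      (reaches v u \/ reaches u v) /\
        (forall w, tree u w \/ tree v w -> ~ bifurcation w) |
      exists c w, [/\ is_cycle c, cycle_vertices c w, reaches w u
                    & reaches w v]].

Definition sim : vertex E -> vertex E -> Prop := clos_trans (vertex E) sim1.

Definition sim_class v : set (vertex E) := [set u | sim v u].

Definition saturated H :=
  forall v, regular v -> (forall e, emitted v e -> H (rng e)) -> H v.

Definition saturated_closure H : set (vertex E) := smallest saturated H.

Definition F_E H : set gpath :=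
  [set p | exists e s, [/\ edges p = rcons s e, ~ H (psrc p),
                           (forall f, f \in s -> ~ H (rng f)) & H (rng e)]].

Definition P_f : set (vertex E) :=
  [set v | [/\ P v, finite_set (saturated_closure (sim_class v))
             & finite_set (F_E (saturated_closure (sim_class v)))]].

Definition X : set (set (vertex E)) := [set sim_class v | v in P].

Definition X_f : set (set (vertex E)) :=
  [set C | X C /\ (forall u, C u -> P u -> P_f u)].

End Graph.

Section LinearAlgebra.
Variables (K : fieldType) (V : lmodType K).

Definition lspan (S : set V) : set V :=
  [set x | exists n (k : 'I_n -> K) (b : 'I_n -> V),
      (forall i, S (b i)) /\ x = \sum_i k i *: b i].

Definition linearly_independent (S : set V) :=
  forall n (k : 'I_n -> K) (b : 'I_n -> V),
    injective b -> (forall i, S (b i)) ->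
    \sum_i k i *: b i = 0 -> forall i, k i = 0.

Definition is_basis (B W : set V) := linearly_independent B /\ lspan B = W.

End LinearAlgebra.

(* L_K(E) is the associative, not necessarily unital, K-algebra presented by
   the given generators and relations. It is built as the quotient of the formal
   algebraic expressions in the generators by the least congruence containing
   the axioms of K-algebras and the relations: MathComp has no structure of
   non-unital algebra, and adjoining a unit would change the algebra. *)
Section Expressions.
Variables (K : fieldType) (E : digraph).

Inductive term :=
  | TVertex of vertex E
  | TEdge of edge E
  | TGhost of edge E
  | TZero
  | TAdd of term & term
  | TScale of K & term
  | TMul of term & term.

HB.instance Definition _ := gen_eqMixin term.
HB.instance Definition _ := gen_choiceMixin term.

Inductive lpa_rel : term -> term -> Prop :=
  | rel_refl x : lpa_rel x x
  | rel_sym x y : lpa_rel x y -> lpa_rel y x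
  | rel_trans x y z : lpa_rel x y -> lpa_rel y z -> lpa_rel x z
  | rel_add x x' y y' :
      lpa_rel x x' -> lpa_rel y y' -> lpa_rel (TAdd x y) (TAdd x' y')
  | rel_scale k x x' : lpa_rel x x' -> lpa_rel (TScale k x) (TScale k x')
  | rel_mul x x' y y' :
      lpa_rel x x' -> lpa_rel y y' -> lpa_rel (TMul x y) (TMul x' y')
  | rel_addA x y z : lpa_rel (TAdd x (TAdd y z)) (TAdd (TAdd x y) z)
  | rel_addC x y : lpa_rel (TAdd x y) (TAdd y x)
  | rel_add0 x : lpa_rel (TAdd TZero x) x
  | rel_addN x : lpa_rel (TAdd (TScale (-1) x) x) TZero
  | rel_scaleA k l x : lpa_rel (TScale k (TScale l x)) (TScale (k * l) x)
  | rel_scale1 x : lpa_rel (TScale 1 x) x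
  | rel_scaleDr k x y :
      lpa_rel (TScale k (TAdd x y)) (TAdd (TScale k x) (TScale k y))
  | rel_scaleDl k l x :
      lpa_rel (TScale (k + l) x) (TAdd (TScale k x) (TScale l x))
  | rel_mulA x y z : lpa_rel (TMul x (TMul y z)) (TMul (TMul x y) z)
  | rel_mulDl x y z : lpa_rel (TMul (TAdd x y) z) (TAdd (TMul x z) (TMul y z))
  | rel_mulDr x y z : lpa_rel (TMul x (TAdd y z)) (TAdd (TMul x y) (TMul x z))
  | rel_mulZl k x y : lpa_rel (TMul (TScale k x) y) (TScale k (TMul x y))
  | rel_mulZr k x y : lpa_rel (TMul x (TScale k y)) (TScale k (TMul x y))
  | rel_vertex v w :
      lpa_rel (TMul (TVertex v) (TVertex w))
              (if v == w then TVertex v else TZero)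
  | rel_src_edge e : lpa_rel (TMul (TVertex (src e)) (TEdge e)) (TEdge e)
  | rel_edge_rng e : lpa_rel (TMul (TEdge e) (TVertex (rng e))) (TEdge e)
  | rel_rng_ghost e : lpa_rel (TMul (TVertex (rng e)) (TGhost e)) (TGhost e)
  | rel_ghost_src e : lpa_rel (TMul (TGhost e) (TVertex (src e))) (TGhost e)
  | rel_CK1 e f :
      lpa_rel (TMul (TGhost e) (TEdge f))
              (if e == f then TVertex (rng e) else TZero)
  | rel_CK2 v : regular v ->
      lpa_rel (TVertex v)
        (\big[TAdd/TZero]_(e <- fset_set (emitted v)) TMul (TEdge e) (TGhost e)).

Definition lpa_relb (x y : term) : bool := `[< lpa_rel x y >].

Lemma lpa_relb_equiv : equiv_class_of lpa_relb.
Proof.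
split.
- by move=> x; apply/asboolP; exact: rel_refl.
- move=> x y; apply/asboolP/asboolP; exact: rel_sym.
- move=> y x z /asboolP xy /asboolP yz; apply/asboolP; exact: rel_trans yz.
Qed.

Canonical lpa_equiv := EquivRelPack lpa_relb_equiv.

End Expressions.

Section LeavittPathAlgebra.
Variables (K : fieldType) (E : digraph).

Definition lpa := {eq_quot lpa_equiv K E}%qT.
HB.instance Definition _ := Choice.on lpa.

Implicit Types x y z : lpa.

Definition lpa_class (t : term K E) : lpa := (\pi_lpa t)%qT.

Lemma lpa_classP s t : lpa_class s = lpa_class t <-> lpa_rel s t.
Proof.
split; first by move=> /eqP; rewrite /lpa_class eqquotE => /asboolP.
by move=> st; apply/eqP; rewrite /lpa_class eqquotE; apply/asboolP.
Qed.

Lemma lpa_repr t : lpa_rel (repr (lpa_class t)) t.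
Proof. by apply/lpa_classP; rewrite /lpa_class reprK. Qed.

Lemma lpa_ind (Q : lpa -> Prop) : (forall t, Q (lpa_class t)) -> forall x, Q x.
Proof. by move=> Qt x; rewrite -[x]reprK; exact: Qt. Qed.

Definition lpa_zero : lpa := lpa_class (@TZero K E).
Definition lpa_add x y : lpa := lpa_class (TAdd (repr x) (repr y)).
Definition lpa_scale k x : lpa := lpa_class (TScale k (repr x)).
Definition lpa_opp x : lpa := lpa_scale (-1) x.
Definition lpa_mul x y : lpa := lpa_class (TMul (repr x) (repr y)).

Lemma lpa_addE s t : lpa_add (lpa_class s) (lpa_class t) = lpa_class (TAdd s t).
Proof. by apply/lpa_classP; apply: rel_add; exact: lpa_repr. Qed.

Lemma lpa_scaleE k t : lpa_scale k (lpa_class t) = lpa_class (TScale k t).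
Proof. by apply/lpa_classP; apply: rel_scale; exact: lpa_repr. Qed.

Lemma lpa_mulE s t : lpa_mul (lpa_class s) (lpa_class t) = lpa_class (TMul s t).
Proof. by apply/lpa_classP; apply: rel_mul; exact: lpa_repr. Qed.

Lemma lpa_addA : associative lpa_add.
Proof.
elim/lpa_ind=> x; elim/lpa_ind=> y; elim/lpa_ind=> z.
by rewrite !lpa_addE; apply/lpa_classP; exact: rel_addA.
Qed.

Lemma lpa_addC : commutative lpa_add.
Proof.
elim/lpa_ind=> x; elim/lpa_ind=> y.
by rewrite !lpa_addE; apply/lpa_classP; exact: rel_addC.
Qed.

Lemma lpa_add0 : left_id lpa_zero lpa_add.
Proof.
by elim/lpa_ind=> x; rewrite lpa_addE; apply/lpa_classP; exact: rel_add0.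
Qed.

Lemma lpa_addN : left_inverse lpa_zero lpa_opp lpa_add.
Proof.
elim/lpa_ind=> x; rewrite /lpa_opp lpa_scaleE lpa_addE.
by apply/lpa_classP; exact: rel_addN.
Qed.

HB.instance Definition _ :=
  GRing.isZmodule.Build lpa lpa_addA lpa_addC lpa_add0 lpa_addN.

Lemma lpa_scaleA k l x : lpa_scale k (lpa_scale l x) = lpa_scale (k * l) x.
Proof.
elim/lpa_ind: x => x; rewrite !lpa_scaleE.
by apply/lpa_classP; exact: rel_scaleA.
Qed.

Lemma lpa_scale1 : left_id 1 lpa_scale.
Proof.
by elim/lpa_ind=> x; rewrite lpa_scaleE; apply/lpa_classP; exact: rel_scale1.
Qed.

Lemma lpa_scaleDr : right_distributive lpa_scale +%R.
Proof.
move=> k; elim/lpa_ind=> x; elim/lpa_ind=> y.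
rewrite /GRing.add /= !(lpa_addE, lpa_scaleE).
by apply/lpa_classP; exact: rel_scaleDr.
Qed.

Lemma lpa_scaleDl x : {morph lpa_scale^~ x : k l / k + l}.
Proof.
move=> k l; elim/lpa_ind: x => x.
rewrite [RHS]/GRing.add /= !lpa_scaleE lpa_addE.
by apply/lpa_classP; exact: rel_scaleDl.
Qed.

HB.instance Definition _ := GRing.Zmodule_isLmodule.Build K lpa
  lpa_scaleA lpa_scale1 lpa_scaleDr lpa_scaleDl.

Definition lpa_vertex (v : vertex E) : lpa := lpa_class (TVertex K v).
Definition lpa_edge (e : edge E) : lpa := lpa_class (TEdge K e).
Definition lpa_ghost (e : edge E) : lpa := lpa_class (TGhost K e).

(* For p = e_1 ... e_n from v these are v e_1 ... e_n and e_n^* ... e_1^* v;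
   the factor v only matters for n = 0 since s(e) e = e and e^* s(e) = e^*. *)
Definition lpa_path (p : gpath E) : lpa :=
  foldl (fun x e => lpa_mul x (lpa_edge e)) (lpa_vertex (psrc p)) (edges p).
Definition lpa_path_star (p : gpath E) : lpa :=
  foldl (fun x e => lpa_mul (lpa_ghost e) x) (lpa_vertex (psrc p)) (edges p).

Definition lpa_homog (n : int) : set lpa :=
  lspan [set x | exists a b : gpath E,
    (plength a)%:Z - (plength b)%:Z = n /\
    x = lpa_mul (lpa_path a) (lpa_path_star b)].

Definition lpa_center : set lpa := [set z | forall x, lpa_mul z x = lpa_mul x z].

Definition lpa_center_homog (n : int) : set lpa := lpa_center `&` lpa_homog n.

Definition a_class (C : set (vertex E)) : lpa :=
  \sum_(u \in saturated_closure C) lpa_vertex u +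
  \sum_(p \in F_E (saturated_closure C)) lpa_mul (lpa_path p) (lpa_path_star p).

Definition B_0 : set lpa := [set a_class C | C in @X_f E].

End LeavittPathAlgebra.

Arguments lpa_center K E : clear implicits.
Arguments lpa_homog K E n : clear implicits.
Arguments lpa_center_homog K E n : clear implicits.
Arguments B_0 K E : clear implicits.

(* Main.v *)
Require Import Defs.
From mathcomp Require Import all_boot all_order all_algebra.
From mathcomp Require Import finmap.
From mathcomp Require Import boolp classical_sets functions cardinality fsbigop.
From Stdlib Require Import Relation_Operators.

(* Let z be central of degree 0. If a path alpha is longer than all those
   occurring in z, or ends in a sink, then alpha* z alpha is a multiple of
   r(alpha), hence z r(alpha) = k r(alpha) for some scalar k. For each k the
   vertices v with z v = k v form a hereditary saturated set H_k; for k <> 0 it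
   is finite, and if z <> 0 then some H_k with k <> 0 is nonempty and, being
   finite and hereditary, meets P. A vertex on a cycle is the range of arbitrarily
   long paths, so it lies in some H_k, and it follows that H_k contains the whole
   class [v] of each of its vertices v. If v is in P and k <> 0, an infinite
   F_E would yield a closed path outside the closure of [v] but leading into
   [v], whose vertices are then in [v]: hence [v] is in X_f. Subtracting k a_[v]
   from z removes [v] from the finite set of vertices of P in H_k, k <> 0, and
   adds none, so that iterating brings z to 0. Conversely a_[v] is central, acts
   as the identity on [v] and kills the other classes, which gives independence
   since vertices are nonzero in L_K(E). *)

Set Implicit Arguments.
Unset Strict Implicit.
Unset Printing Implicit Defensive.

Import GRing.Theory.

Local Open Scope classical_set_scope.
Local Open Scope ring_scope.

(** * Paths, closed paths and terminal vertices of a graph *)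

Section Graph.
Variable E : digraph.
Implicit Types (u v w : vertex E) (e f : edge E) (s t : seq (edge E)).
Implicit Types H : set (vertex E).

Definition target v s : vertex E := last v (map (@rng E) s).

Lemma composable_cat v s t :
  composable v (s ++ t) = composable v s && composable (target v s) t.
Proof. by elim: s v => //= e s IHs v; rewrite IHs andbA. Qed.

Lemma target_cat v s t : target v (s ++ t) = target (target v s) t.
Proof. by rewrite /target map_cat last_cat. Qed.

Lemma reachesP v w : reaches v w <-> exists2 s, composable v s & target v s = w.
Proof.
split=> [[[[u s] us] [/= <- <-]]|[s vs <-]]; first by exists s.
by exists (exist _ (v, s) vs).
Qed.

Lemma reaches_refl v : reaches v v.
Proof. by apply/reachesP; exists [::]. Qed.

Lemma reaches_trans u v w : reaches u v -> reaches v w -> reaches u w.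
Proof.
move=> /reachesP[s us <-] /reachesP[t vt <-]; apply/reachesP; exists (s ++ t).
  by rewrite composable_cat us.
exact: target_cat.
Qed.

Lemma reaches_edge e : reaches (src e) (rng e).
Proof. by apply/reachesP; exists [:: e]; rewrite //= eqxx. Qed.

Lemma reaches_ind_r (Q : vertex E -> Prop) w :
  Q w -> (forall e, reaches (rng e) w -> Q (rng e) -> Q (src e)) ->
  forall v, reaches v w -> Q v.
Proof.
move=> Qw IH v /reachesP[s vs sw]; elim: s v vs sw => [|e s IHs] v /=.
  by rewrite /target => _ /= ->.
move=> /andP[/eqP <- es] sw; apply: IH; last exact: IHs.
by apply/reachesP; exists s.
Qed.

Lemma reaches_inv v w :
  reaches v w -> v = w \/ exists2 e, src e = v & reaches (rng e) w.
Proof.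
move: v; apply: reaches_ind_r; first by left.
by move=> e ew _; right; exists e.
Qed.

Lemma mem_path_reaches v s e : composable v s -> e \in s ->
  reaches v (src e) /\ reaches (rng e) (target v s).
Proof.
elim: s v => //= f s IHs v /andP[/eqP <- fs].
rewrite inE => /orP[/eqP ->|/(IHs _ fs)[fe es]].
  by split; [exact: reaches_refl|apply/reachesP; exists s].
by split=> //; apply: reaches_trans fe; exact: reaches_edge.
Qed.

Definition hereditary H := forall e, H (src e) -> H (rng e).

Lemma hereditary_reaches H v w : hereditary H -> reaches v w -> H v -> H w.
Proof. by move=> hH; move: v; apply: reaches_ind_r => // e _ IH /hH. Qed.

(** The closed path may repeat vertices; [closed_at_cycle] and [cycle_closed_at] show that such v
    are exactly the vertices of cycles. *)
Definition closed_at v := exists2 e, src e = v & reaches (rng e) v.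

(** Passing to the sequence of vertices makes [shortenP] applicable; this goes back to edges after
    the shortening. *)
Lemma vertex_path_lift v (p : seq (vertex E)) :
  path (fun x y => `[< exists2 e, src e = x & rng e = y >]) v p ->
  exists s, [/\ composable v s, map (@rng E) s = p & map (@src E) s = belast v p].
Proof.
elim: p v => [|w p IHp] v /=; first by exists [::].
move=> /andP[/asboolP[e <- <-] /IHp[s [es sp ss]]].
by exists (e :: s); rewrite /= eqxx sp ss.
Qed.

Lemma vertex_path_proj v s : composable v s ->
  path (fun x y => `[< exists2 e, src e = x & rng e = y >]) v (map (@rng E) s).
Proof.
elim: s v => //= e s IHs v /andP[/eqP ev es]; rewrite IHs // andbT.
by apply/asboolP; exists e.
Qed.

(** The way back from the range of the first edge is shortened until it repeats no vertex, then the
    first edge is put in front. *)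
Lemma closed_at_cycle v :
  closed_at v -> exists2 c : gpath E, is_cycle c & cycle_vertices c v.
Proof.
move=> [e ev /reachesP[s0 es0]]; rewrite /target.
case/shortenP: (vertex_path_proj es0) => p /vertex_path_lift[s [es <- ss]] up _.
move=> sv.
have vs : composable v (e :: s) by rewrite /= ev eqxx.
exists (exist _ (v, e :: s) vs); last by exists e; rewrite // mem_head.
(* The sources are the last vertex of the shortened path followed by its other vertices: a rotation
   of a list without repetition. *)
split=> //; rewrite /edges /= ss ev -{1}sv.
by rewrite -rcons_uniq -lastI.
Qed.

Lemma cycle_closed_at (c : gpath E) v :
  is_cycle c -> cycle_vertices c v -> closed_at v.
Proof.
case: c => [[w s] ws] [_ /= wE _] [e es <-]; exists e => //.
have [we ew] := mem_path_reaches ws es.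
by apply: reaches_trans ew _; rewrite /target -[last _ _]wE.
Qed.

Lemma cycle_reaches (c : gpath E) v w :
  is_cycle c -> cycle_vertices c v -> cycle_vertices c w -> reaches v w.
Proof.
case: c => [[u s] us] [_ /= uE _] [e es <-] [f fs <-].
have [_ eu] := mem_path_reaches us es; have [uf _] := mem_path_reaches us fs.
apply: reaches_trans (reaches_edge e) _; apply: reaches_trans eu _.
by rewrite /target -[last _ _]uE.
Qed.

Lemma closed_at_long v n : closed_at v ->
  exists s, [/\ composable v s, target v s = v & (n <= size s)%N].
Proof.
move=> [e ev /reachesP[t et tv]].
elim: n => [|n [s [vs sv ns]]]; first by exists [::].
exists (e :: t ++ s); split=> /=.
- by rewrite ev eqxx composable_cat et tv.
- by rewrite -[LHS]/(target (rng e) (t ++ s)) target_cat tv.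
- by rewrite ltnS size_cat (leq_trans ns) // leq_addl.
Qed.

(** The edges between two occurrences of one source form a closed path. *)
Lemma repeated_closed_at v s : composable v s -> ~~ uniq (map (@src E) s) ->
  exists2 e, e \in s & closed_at (src e).
Proof.
elim: s v => //= e s IHs v /andP[_ es]; rewrite negb_and negbK.
case/orP=> [/mapP[f fs ef]|/(IHs _ es)[f fs cf]].
  exists e; rewrite ?mem_head //; exists e => //; rewrite ef.
  by have [] := mem_path_reaches es fs.
by exists f; rewrite // inE fs orbT.
Qed.

(** If some w below v does not lead back to v, then v is not in T(w), so the search continues from w
    with v removed from l. *)
Lemma terminal_vertex (l : seq (vertex E)) v : (forall w, reaches v w -> w \in l) ->
  exists2 w, reaches v w & forall u, reaches w u -> reaches u w.
Proof.
have [n] := ubnP (size l); elim: n l v => // n IHn l v ln Tl.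
have [Tv|/existsNP[w /not_implyP[vw wv]]] :=
  pselect (forall w, reaches v w -> reaches w v).
  by exists v => //; exact: reaches_refl.
have [||u wu Tu] := IHn (rem v l) w.
- have vl : v \in l by apply/Tl/reaches_refl.
  by rewrite size_rem // -ltnS (leq_trans _ ln) // ltnS prednK // lt0n size_eq0;
     case: (l) vl.
- move=> u wu; have ul : u \in l by apply/Tl/(reaches_trans vw).
  move: (ul); rewrite (perm_mem (perm_to_rem (_ : v \in l))) ?inE.
    by case/orP=> // /eqP uv; case: wv; rewrite -uv.
  exact/Tl/reaches_refl.
by exists u => //; exact: reaches_trans vw wu.
Qed.

(** A terminal vertex that emits an edge lies on a cycle, which has no exit or is extreme because
    every path from it leads back; otherwise the vertex is a sink and lies in [P_l]. *)
Lemma finite_hereditary_meets_P (l : seq (vertex E)) H :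
  hereditary H -> (forall w, H w -> w \in l) -> H !=set0 -> H `&` @P E !=set0.
Proof.
move=> hH Hl [v0 Hv0].
have [w vw|v v0v Tv] := @terminal_vertex l v0.
  exact/Hl/(hereditary_reaches hH vw).
exists v; split; first exact: hereditary_reaches v0v _.
have [[e ev]|Nv] := pselect (exists e, src e = v).
  have [|c cc cv] := @closed_at_cycle v.
    by exists e => //; apply: Tv; rewrite -ev; exact: reaches_edge.
  have [ce|ce] := pselect (has_exit c); last by left; right; exists c.
  right; exists c => //; split=> // l' /(cycle_reaches cc cv) vl'.
  have [m [ms mr]] : reaches (prng l') v.
    by apply: Tv; apply: reaches_trans vl' _; exists l'.
  by exists m; rewrite mr.
have T1 w : reaches v w -> w = v.
  by case/reaches_inv=> // -[e ev _]; case: Nv; exists e.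
left; left; split=> [w /T1 -> [e [f [ev _ _]]]|[c [cc cv]]].
  by case: Nv; exists e.
have [e es] : exists e, e \in edges c.
  by case: cc => + _ _; rewrite /plength; case: (edges c) => // e s _;
     exists e; rewrite mem_head.
by case: Nv; exists e; apply/T1/cv; exists e.
Qed.

End Graph.

(** * The classes [v], their saturated closures and the paths entering them *)

Section Classes.
Variable E : digraph.
Implicit Types (u v w : vertex E) (e f : edge E) (s t : seq (edge E)).
Implicit Types H C : set (vertex E).

Lemma sim1_sym u v : sim1 u v -> sim1 v u.
Proof.
case=> [->|[uv nb]|[c [w [cc cw wu wv]]]]; first by constructor 1.
  constructor 2; split; first by case: uv; [right|left].
  by move=> w uw; apply: nb; case: uw; [right|left].
by constructor 3; exists c, w.
Qed.

Lemma sim_refl v : sim v v.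
Proof. by apply: t_step; constructor 1. Qed.

Lemma sim_trans u v w : sim u v -> sim v w -> sim u w.
Proof. exact: t_trans. Qed.

Lemma sim_sym u v : sim u v -> sim v u.
Proof.
elim=> [x y /sim1_sym|x y z _ yx _ zy]; first exact: t_step.
exact: sim_trans zy yx.
Qed.

Lemma sim_invariant (Q : vertex E -> Prop) :
  (forall u v, sim1 u v -> Q u -> Q v) -> forall u v, sim u v -> Q u -> Q v.
Proof.
by move=> Q1 u v; elim=> [x y /Q1 //|x y z _ xy _ yz /xy /yz].
Qed.

Lemma sim_class_eq u v w : sim_class u w -> sim_class v w -> sim_class u = sim_class v.
Proof.
move=> uw vw; apply/seteqP; split=> x; last first.
  exact/sim_trans/(sim_trans uw (sim_sym vw)).
exact/sim_trans/(sim_trans vw (sim_sym uw)).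
Qed.

Lemma closed_at_sim u v : closed_at u -> reaches u v -> sim u v.
Proof.
move=> /closed_at_cycle[c cc cu] uv; apply: t_step; constructor 3.
by exists c, u; split=> //; exact: reaches_refl.
Qed.

(** Vertices of [P_l] fall under the second clause of [sim1]; the others in [P] lie on cycles and
    fall under the third. *)
Lemma P_sim1_edge e : P (src e) -> sim1 (src e) (rng e).
Proof.
have ee := reaches_edge e.
have cyc c : is_cycle c -> cycle_vertices c (src e) -> sim1 (src e) (rng e).
  by move=> cc ce; constructor 3; exists c, (src e); split=> //; exact: reaches_refl.
case=> [[[nb _]|[c [cc _ ce]]]|[c [cc _ _] ce]]; try exact: cyc ce.
constructor 2; split; first by right.
by move=> w [/nb //|ew]; apply/nb/(reaches_trans ee).
Qed.

(** A vertex of [v] need not lie in [P], so the property carried along a chain of [sim1] steps is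
    instead that every edge leaving the vertex is itself a [sim1] step. *)
Lemma sim_class_hereditary v : P v -> hereditary (sim_class v).
Proof.
move=> Pv e ve.
have : forall f, src f = src e -> sim1 (src e) (rng f).
  apply: (@sim_invariant (fun u => forall f, src f = u -> sim1 u (rng f))) ve _.
    move=> u w [-> //|[_ nb] _ f fw|[c [x [cc cx xu xw]]] _ f fw].
      have wf : reaches w (rng f) by rewrite -fw; exact: reaches_edge.
      constructor 2; split=> [|y wy]; first by right.
      by apply: nb; right; case: wy => // fy; apply: reaches_trans fy.
    constructor 3; exists c, x; split=> //.
    by apply: reaches_trans xw _; rewrite -fw; exact: reaches_edge.
  by move=> f fv; rewrite -fv; apply: P_sim1_edge; rewrite fv.
by move=> /(_ _ erefl) ee; apply: sim_trans ve _; exact: t_step.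
Qed.

Lemma closure_sub H : H `<=` saturated_closure H.
Proof. exact: sub_smallest. Qed.

Lemma closure_min H G : saturated G -> H `<=` G -> saturated_closure H `<=` G.
Proof. by move=> Gs HG; apply: smallest_sub. Qed.

Lemma closure_saturated H : saturated (saturated_closure H).
Proof.
move=> v rv Hv G [Gs HG]; apply: (Gs) => // e ev.
exact: (closure_min Gs HG) (Hv e ev).
Qed.

(** By minimality, it suffices that the vertices of the closure whose edges all end in the closure
    form a saturated set containing H. *)
Lemma closure_hereditary H : hereditary H -> hereditary (saturated_closure H).
Proof.
move=> hH e.
suff : saturated_closure H `<=` [set v | saturated_closure H v /\
    forall f, src f = v -> saturated_closure H (rng f)].
  by move=> sub /sub[_]; exact.
apply: closure_min => [v rv Hv|v Hv].
  by split=> [|f fv]; [apply: closure_saturated => // f fv|]; have [] := Hv f fv.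
split=> [|f fv]; first exact: closure_sub.
by apply: closure_sub; apply: (hH f); rewrite fv.
Qed.

(** The vertices that reach H form a saturated set, because a regular vertex emits at least one
    edge. *)
Lemma closure_reaches H v :
  saturated_closure H v -> exists2 w, H w & reaches v w.
Proof.
move: v; apply: (@closure_min H [set v | exists2 w, H w & reaches v w]).
  move=> v [_ [e ev]] /(_ e ev)[w Hw ew]; exists w => //.
  by apply: reaches_trans ew; rewrite -ev; exact: reaches_edge.
by move=> v Hv; exists v => //; exact: reaches_refl.
Qed.

(** From the closure of [v] one reaches [v] itself; by heredity of [v'] the vertex reached lies in
    both classes. *)
Lemma sim_class_closure_disjoint v v' u w : P v -> P v' ->
  sim_class v' u -> reaches u w -> saturated_closure (sim_class v) w ->
  sim_class v = sim_class v'.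
Proof.
move=> Pv Pv' v'u uw /closure_reaches[x vx wx].
apply: sim_class_eq vx _; apply: hereditary_reaches v'u.
  exact: sim_class_hereditary.
exact: reaches_trans wx.
Qed.

(* The paths of F_E(H) together with, for v in H, the path of length 0 at v. *)
Fixpoint first_entry H v s : Prop :=
  if s is e :: s' then [/\ src e = v, ~ H v & first_entry H (rng e) s'] else H v.

Lemma first_entry_composable H v s : first_entry H v s -> composable v s.
Proof. by elim: s v => //= e s IHs v [-> _ /IHs]; rewrite eqxx. Qed.

Lemma first_entry_target H v s : first_entry H v s -> H (target v s).
Proof. by elim: s v => //= e s IHs v [_ _ /IHs]. Qed.

Lemma first_entry_mem H v s e : first_entry H v s -> e \in s -> ~ H (src e).
Proof.
elim: s v => //= f s IHs v [fv Hv fs].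
by rewrite inE => /orP[/eqP ->|/(IHs _ fs)//]; rewrite fv.
Qed.

Lemma first_entry_nil H v s : H v -> first_entry H v s -> s = [::].
Proof. by case: s => //= e s Hv []. Qed.

(** Translates the recursion from the front into the form of [F_E], which singles out the last
    edge. *)
Lemma first_entry_rcons H v s e : first_entry H v (rcons s e) <->
  [/\ composable v (rcons s e), ~ H v, (forall f, f \in s -> ~ H (rng f))
    & H (rng e)].
Proof.
elim: s v => [|f s IHs] v /=.
  by split=> [[-> ? ?]|[/andP[/eqP ? _] ? _ ?]]; rewrite ?eqxx; split.
split=> [[-> Hv /IHs[-> Hf Hs He]]|[/andP[/eqP fv fs] Hv Hs He]].
  rewrite eqxx; split=> // g; rewrite inE => /orP[/eqP -> //|]; exact: Hs.
split=> //; apply/IHs; split=> // [|g gs]; apply: Hs.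
  exact: mem_head.
by rewrite inE gs orbT.
Qed.

Lemma F_EP H (p : gpath E) :
  F_E H p <-> first_entry H (psrc p) (edges p) /\ edges p <> [::].
Proof.
split=> [[e [s [ps Hp Hs He]]]|].
  split; last by rewrite ps; case: (s).
  by rewrite ps; apply/first_entry_rcons; split=> //; rewrite -ps; exact: (valP p).
move=> [+ np]; have [s [e ps]] : exists s e, edges p = rcons s e.
  by case/lastP: (edges p) np => // s e _; exists s, e.
rewrite ps => /first_entry_rcons[_ Hp Hs He]; exists e, s; split=> //.
Qed.

(** A single index set for both sums of a_[v]: empty lists stand for the vertices of H, the other
    lists for [F_E]. *)
Definition first_entries H : set (vertex E * seq (edge E)) :=
  [set x | first_entry H x.1 x.2].

Lemma finite_composable v n : row_finite E ->
  finite_set [set s | composable v s /\ (size s <= n)%N].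
Proof.
move=> rfE; elim: n v => [|n IHn] v.
  apply: (@sub_finite_set _ _ [set [::]]); last exact: finite_set1.
  by move=> [|e s] [].
pose D e := cons e @` [set s | composable (rng e) s /\ (size s <= n)%N].
apply: (@sub_finite_set _ _ ([set [::]] `|` \bigcup_(e in emitted v) D e)).
  move=> [|e s] /= [+ ns]; first by left.
  by move=> /andP[/eqP ev es]; right; exists e => //; exists s.
rewrite finite_setU; split; first exact: finite_set1.
by apply: bigcup_finite => // e _; exact/finite_image/IHn.
Qed.

Lemma finite_first_entries H (l : seq (vertex E)) n : row_finite E ->
  (forall v s, first_entry H v s -> v \in l /\ (size s <= n)%N) ->
  finite_set (first_entries H).
Proof.
move=> rfE bH; pose D v := pair v @` [set s | composable v s /\ (size s <= n)%N].
apply: (@sub_finite_set _ _ (\bigcup_(v in [set` l]) D v)).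
  move=> [v s] /= vs; have [vl sn] := bH _ _ vs; exists v => //; exists s => //.
  by split=> //; exact: first_entry_composable vs.
by apply: bigcup_finite => // v _; exact/finite_image/finite_composable.
Qed.

Lemma finite_first_entriesP H : finite_set (first_entries H) <->
  finite_set H /\ finite_set (F_E H).
Proof.
have -> : first_entries H = (pair^~ [::] @` H) `|` (val @` F_E H).
  apply/seteqP; split=> [[v [|e s]] /= vs|x [[v Hv <-] //|[p /F_EP[pH _] <-] //]].
    by left; exists v.
  right; exists (exist _ (v, e :: s) (first_entry_composable vs)) => //.
  exact/F_EP.
rewrite finite_setU; split=> -[]; last first.
  by move=> /finite_image fH /finite_image fF; split; [exact: fH|exact: fF].
move=> fH fF; split.
  apply: (sub_finite_set _ (finite_image fst fH)) => v Hv.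
  by exists (v, [::]) => //; exists v.
have -> : F_E H = val @^-1` (val @` F_E H).
  by apply/seteqP; split=> [p Fp|p [q Fq /val_inj <-] //]; exists p.
by apply: finite_preimage fF => p q _ _; exact: val_inj.
Qed.

End Classes.

Local Notation "x ** y" := (lpa_mul x y) (at level 40, left associativity).

(** * Computation rules in L_K(E) and the nonvanishing of vertices *)

Section Algebra.
Variables (K : fieldType) (E : digraph).
Implicit Types (x y z : lpa K E) (k : K).
Implicit Types (u v w : vertex E) (e f : edge E) (s t : seq (edge E)).
Implicit Types H : set (vertex E).

Notation V v := (lpa_vertex K v).
Notation ed e := (lpa_edge K e).
Notation gh e := (lpa_ghost K e).

Lemma lpa_mulA : associative (@lpa_mul K E).
Proof.
elim/lpa_ind=> x; elim/lpa_ind=> y; elim/lpa_ind=> z.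
by rewrite !lpa_mulE; apply/lpa_classP; exact: rel_mulA.
Qed.

Lemma lpa_mulDl : left_distributive (@lpa_mul K E) +%R.
Proof.
elim/lpa_ind=> x; elim/lpa_ind=> y; elim/lpa_ind=> z.
rewrite /GRing.add /= !(lpa_addE, lpa_mulE).
by apply/lpa_classP; exact: rel_mulDl.
Qed.

Lemma lpa_mulDr : right_distributive (@lpa_mul K E) +%R.
Proof.
elim/lpa_ind=> x; elim/lpa_ind=> y; elim/lpa_ind=> z.
rewrite /GRing.add /= !(lpa_addE, lpa_mulE).
by apply/lpa_classP; exact: rel_mulDr.
Qed.

Lemma lpa_mulZl k x y : (k *: x) ** y = k *: (x ** y).
Proof.
elim/lpa_ind: x => x; elim/lpa_ind: y => y.
rewrite /GRing.scale /= !(lpa_scaleE, lpa_mulE).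
by apply/lpa_classP; exact: rel_mulZl.
Qed.

Lemma lpa_mulZr k x y : x ** (k *: y) = k *: (x ** y).
Proof.
elim/lpa_ind: x => x; elim/lpa_ind: y => y.
rewrite /GRing.scale /= !(lpa_scaleE, lpa_mulE).
by apply/lpa_classP; exact: rel_mulZr.
Qed.

Lemma lpa_mul0l x : 0 ** x = 0.
Proof. by rewrite -[0 in LHS](scale0r 0) lpa_mulZl scale0r. Qed.

Lemma lpa_mul0r x : x ** 0 = 0.
Proof. by rewrite -[0 in LHS](scale0r 0) lpa_mulZr scale0r. Qed.

Lemma lpa_mul_suml I (r : seq I) (Q : pred I) (F : I -> lpa K E) x :
  (\sum_(i <- r | Q i) F i) ** x = \sum_(i <- r | Q i) F i ** x.
Proof.
by apply: (big_morph (fun y => y ** x)) => [y z|]; rewrite ?lpa_mul0l ?lpa_mulDl.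
Qed.

Lemma lpa_mul_sumr I (r : seq I) (Q : pred I) (F : I -> lpa K E) x :
  x ** (\sum_(i <- r | Q i) F i) = \sum_(i <- r | Q i) x ** F i.
Proof.
by apply: (big_morph (fun y => x ** y)) => [y z|]; rewrite ?lpa_mul0r ?lpa_mulDr.
Qed.

Lemma vertex_mul v w : V v ** V w = if v == w then V v else 0.
Proof.
rewrite lpa_mulE; have /lpa_classP -> := rel_vertex K v w.
by case: ifP.
Qed.

Lemma src_edge e : V (src e) ** ed e = ed e.
Proof. by rewrite lpa_mulE; apply/lpa_classP; exact: rel_src_edge. Qed.

Lemma edge_rng e : ed e ** V (rng e) = ed e.
Proof. by rewrite lpa_mulE; apply/lpa_classP; exact: rel_edge_rng. Qed.

Lemma rng_ghost e : V (rng e) ** gh e = gh e.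
Proof. by rewrite lpa_mulE; apply/lpa_classP; exact: rel_rng_ghost. Qed.

Lemma ghost_src e : gh e ** V (src e) = gh e.
Proof. by rewrite lpa_mulE; apply/lpa_classP; exact: rel_ghost_src. Qed.

Lemma ghost_edge e f : gh e ** ed f = if e == f then V (rng e) else 0.
Proof.
rewrite lpa_mulE; have /lpa_classP -> := rel_CK1 K e f.
by case: ifP.
Qed.

Lemma vertex_CK2 v : regular v ->
  V v = \sum_(e <- fset_set (emitted v)) ed e ** gh e.
Proof.
move=> rv; have /lpa_classP := rel_CK2 K rv; rewrite /lpa_vertex => ->.
rewrite (big_morph (@lpa_class K E) (id1 := 0) (op1 := +%R)) //; last first.
  by move=> s t; rewrite -lpa_addE.
by apply: eq_bigr => e _; rewrite -lpa_mulE.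
Qed.

Lemma vertex_mul_id v : V v ** V v = V v.
Proof. by rewrite vertex_mul eqxx. Qed.

Lemma vertex_edge v e : V v ** ed e = if v == src e then ed e else 0.
Proof.
rewrite -{1}src_edge lpa_mulA vertex_mul; case: eqP => [->|_]; first exact: src_edge.
by rewrite lpa_mul0l.
Qed.

Lemma edge_vertex v e : ed e ** V v = if rng e == v then ed e else 0.
Proof.
rewrite -{1}edge_rng -lpa_mulA vertex_mul; case: eqP => [_|_]; first exact: edge_rng.
by rewrite lpa_mul0r.
Qed.

Lemma lpa_classD (s t : term K E) : @lpa_class K E (TAdd s t) = lpa_class s + lpa_class t.
Proof. exact/esym/lpa_addE. Qed.

Lemma lpa_classZ k (t : term K E) : @lpa_class K E (TScale k t) = k *: lpa_class t.
Proof. exact/esym/lpa_scaleE. Qed.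

(** Induction on an expression for the other factor: what commutes with z is closed under the
    operations. *)
Lemma central_ext z : (forall v, z ** V v = V v ** z) ->
  (forall e, z ** ed e = ed e ** z) -> (forall e, z ** gh e = gh e ** z) ->
  lpa_center K E z.
Proof.
move=> zV ze zg; elim/lpa_ind; elim=> [v|e|e||s IHs t IHt|k t IHt|s IHs t IHt].
- exact: zV.
- exact: ze.
- exact: zg.
- by rewrite -[lpa_class _]/(0 : lpa K E) lpa_mul0l lpa_mul0r.
- by rewrite lpa_classD lpa_mulDl lpa_mulDr IHs IHt.
- by rewrite lpa_classZ lpa_mulZl lpa_mulZr IHt.
- by rewrite -lpa_mulE lpa_mulA IHs -lpa_mulA IHt lpa_mulA.
Qed.

Lemma mem_emitted v e : row_finite E ->
  (e \in fset_set (emitted v)) = (src e == v).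
Proof.
by move=> rfE; rewrite in_fset_set; [apply/idP/eqP; rewrite inE|exact: rfE].
Qed.

(** Expanding the regular vertex s(e), e* z = e* z s(e) is the sum of the e* z f f* = e* f z f* over
    the edges f leaving s(e), and only f = e contributes. *)
Lemma central_ghost z : row_finite E -> (forall v, z ** V v = V v ** z) ->
  (forall e, z ** ed e = ed e ** z) -> forall e, z ** gh e = gh e ** z.
Proof.
move=> rfE zV ze e.
have re : regular (src e) by split; [exact: rfE|exists e].
rewrite -[gh e in RHS]ghost_src -lpa_mulA -zV (vertex_CK2 re).
rewrite lpa_mul_sumr lpa_mul_sumr.
rewrite (bigD1_seq e) ?fset_uniq ?mem_emitted //=.
rewrite big1 ?addr0 => [|f fe]; rewrite (lpa_mulA z) ze !lpa_mulA ghost_edge.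
- by rewrite eqxx -zV -lpa_mulA rng_ghost.
- by rewrite eq_sym (negPf fe) !lpa_mul0l.
Qed.

Section Representation.
Hypothesis rfE : row_finite E.

Let arity e := size (fset_set (emitted (src e))).
Let rank e := index e (fset_set (emitted (src e))).

Let rank_lt e : (rank e < arity e)%N.
Proof. by rewrite index_mem mem_emitted. Qed.

Let rank_inj e f : src e = src f -> rank e = rank f -> e = f.
Proof.
rewrite /rank => ef; rewrite ef.
have mem g : src g = src f -> g \in enum_fset (fset_set (emitted (src f))).
  by move=> gf; rewrite -[_ \in _]/(g \in fset_set _) mem_emitted // gf.
exact: (index_inj e (mem _ ef) (mem _ erefl)).
Qed.

(* An action on the functions on vertex * nat, killing no vertex: a regular
   vertex v with n edges splits the fibre over v into residue classes modulo n,
   and its i-th edge identifies the class of i with the fibre over its range. *)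
Fixpoint interp (t : term K E) (g : vertex E * nat -> K) : vertex E * nat -> K :=
  match t with
  | TVertex v => fun a => if a.1 == v then g a else 0
  | TEdge e => fun a => if (a.1 == src e) && (a.2 %% arity e == rank e)%N
                        then g (rng e, a.2 %/ arity e)%N else 0
  | TGhost e => fun a => if a.1 == rng e then g (src e, a.2 * arity e + rank e)%N
                         else 0
  | TZero => fun _ => 0
  | TAdd s t => fun a => interp s g a + interp t g a
  | TScale k t => fun a => k * interp t g a
  | TMul s t => interp s (interp t g)
  end.

(** Needed for the relations [rel_mulDr] and [rel_mulZr], where the left factor acts on a sum or a
    multiple. *)
Lemma interp_linear (t : term K E) k (g h : vertex E * nat -> K) :
  interp t (fun a => k * g a + h a) = fun a => k * interp t g a + interp t h a.
Proof.
elim: t g h k => [v|e|e||s IHs t IHt|l t IHt|s IHs t IHt] g h k; apply/funext=> a /=.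
- by case: ifP => _ //; rewrite mulr0 addr0.
- by case: ifP => _ //; rewrite mulr0 addr0.
- by case: ifP => _ //; rewrite mulr0 addr0.
- by rewrite mulr0 addr0.
- by rewrite IHs IHt mulrDr addrACA.
- by rewrite IHt mulrDr mulrCA.
- by rewrite IHt IHs.
Qed.

Lemma interp0 (t : term K E) : interp t (fun=> 0) = fun=> 0.
Proof.
have := interp_linear t (-1) (fun=> 0) (fun=> 0).
rewrite (_ : (fun a => _) = (fun=> 0)); last by apply/funext=> a; rewrite mulr0 addr0.
by move=> ->; apply/funext=> a; rewrite mulN1r addNr.
Qed.

Lemma interp_rel (s t : term K E) : lpa_rel s t -> interp s = interp t.
Proof.
elim=> //=.
- by move=> x y z _ ->.
- by move=> x x' y y' _ -> _ ->.
- by move=> k x x' _ ->.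
- by move=> x x' y y' _ -> _ ->.
- by move=> x y z; apply/funext=> g; apply/funext=> a; rewrite addrA.
- by move=> x y; apply/funext=> g; apply/funext=> a; rewrite addrC.
- by move=> x; apply/funext=> g; apply/funext=> a; rewrite add0r.
- by move=> x; apply/funext=> g; apply/funext=> a; rewrite mulN1r addNr.
- by move=> k l x; apply/funext=> g; apply/funext=> a; rewrite mulrA.
- by move=> x; apply/funext=> g; apply/funext=> a; rewrite mul1r.
- by move=> k x y; apply/funext=> g; apply/funext=> a; rewrite mulrDr.
- by move=> k l x; apply/funext=> g; apply/funext=> a; rewrite mulrDl.
- move=> x y z; apply/funext=> g; apply/funext=> a.
  have := interp_linear x 1 (interp y g) (interp z g).
  by under eq_fun do rewrite mul1r; move=> ->; rewrite mul1r.
- move=> k x y; apply/funext=> g; apply/funext=> a.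
  have := interp_linear x k (interp y g) (fun=> 0).
  by under eq_fun do rewrite addr0; move=> ->; rewrite interp0 addr0.
- move=> v w; apply/funext=> g; apply/funext=> a.
  case: (eqVneq v w) => [<-|vw] /=; first by case: eqP.
  by case: eqP => // ->; rewrite (negPf vw).
- move=> e; apply/funext=> g; apply/funext=> a.
  by case: eqP => //= ->; rewrite eqxx.
- by move=> e; apply/funext=> g; apply/funext=> a; rewrite eqxx.
- by move=> e; apply/funext=> g; apply/funext=> a; case: eqP.
- by move=> e; apply/funext=> g; apply/funext=> a; rewrite eqxx.
- move=> e f; apply/funext=> g; apply/funext=> -[a m] /=.
  case: (eqVneq (src e) (src f)) => [ef|ef]; last first.
    rewrite if_same; case: (eqVneq e f) => [ef'|] //=.
    by rewrite ef' eqxx in ef.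
  (* Dividing m * n + i by n, with i < n, gives back m and i; different edges with one source have
     different i. *)
  rewrite /arity -ef -/(arity e) modnMDl modn_small // divnMDl; last first.
    by apply: leq_ltn_trans (rank_lt e).
  rewrite divn_small // addn0; case: (eqVneq e f) => [<-|nef] /=.
    by rewrite eqxx; case: eqP => // ->.
  case: eqP => // _; case: eqP => // /(rank_inj ef) ef'.
  by rewrite ef' eqxx in nef.
- move=> v [_ [e0 ve0]]; apply/funext=> g; apply/funext=> -[a m] /=.
  rewrite (big_morph (fun t : term K E => interp t g (a, m))
    (id1 := 0) (op1 := +%R)) //=.
  case: (eqVneq a v) => [->|av]; last first.
    rewrite big_seq big1 // => e; rewrite mem_emitted // => /eqP ve.
    by rewrite ve (negPf av).
  set r := fset_set _.
  have rE e : src e = v -> arity e = size r /\ rank e = index e r.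
    by rewrite /arity /rank => ->.
  have er0 : (m %% size r < size r)%N.
    rewrite ltn_mod -has_predT; apply/hasP.
    by exists e0; rewrite // mem_emitted //; apply/eqP.
  (* Only the edge whose rank is the residue of m contributes; quotient and residue reassemble m. *)
  rewrite (bigD1_seq (nth e0 r (m %% size r))) ?fset_uniq ?mem_nth //=.
  have src_r e : e \in r -> src e = v by rewrite mem_emitted // => /eqP.
  have [-> ->] := rE _ (src_r _ (mem_nth e0 er0)).
  rewrite index_uniq ?fset_uniq // src_r ?mem_nth // !eqxx /= -divn_eq.
  rewrite big_seq_cond big1 ?addr0 // => e /andP[er ne].
  have [-> ->] := rE _ (src_r _ er); rewrite src_r // eqxx /=.
  by case: eqP => // me; rewrite me nth_index ?eqxx in ne.
Qed.

(** The action is evaluated on the constant function 1, at a point over v. *)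
Lemma vertex_scale_eq0 k v : k *: V v = 0 -> k = 0.
Proof.
rewrite -lpa_classZ => /lpa_classP /interp_rel.
move=> /(congr1 (fun h => h (fun=> 1) (v, 0%N))) /=.
by rewrite eqxx mulr1.
Qed.

End Representation.

End Algebra.

(** * Monomials, and the elements a_[v] as central elements *)

Section Paths.
Variables (K : fieldType) (E : digraph).
Implicit Types (x y z : lpa K E) (k : K).
Implicit Types (u v w : vertex E) (e f : edge E) (s t : seq (edge E)).
Implicit Types H : set (vertex E).

Notation V v := (lpa_vertex K v).
Notation ed e := (lpa_edge K e).
Notation gh e := (lpa_ghost K e).

(* The values in L_K(E) of a path and of its ghost path, by recursion on the edges
   instead of the left folds of lpa_path and lpa_path_star. *)
Fixpoint ep v s : lpa K E := if s is e :: s' then ed e ** ep (rng e) s' else V v.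
Fixpoint gp v s : lpa K E := if s is e :: s' then gp (rng e) s' ** gh e else V v.

Lemma vertex_ep v s : composable v s -> V v ** ep v s = ep v s.
Proof.
case: s => [|e s] /=; first by rewrite vertex_mul_id.
by move=> /andP[/eqP <- _]; rewrite lpa_mulA src_edge.
Qed.

Lemma gp_vertex v s : composable v s -> gp v s ** V v = gp v s.
Proof.
case: s => [|e s] /=; first by rewrite vertex_mul_id.
by move=> /andP[/eqP <- _]; rewrite -lpa_mulA ghost_src.
Qed.

Lemma gp_ep v s : composable v s -> gp v s ** ep v s = V (target v s).
Proof.
elim: s v => [|e s IHs] v /=; first by rewrite vertex_mul_id.
move=> /andP[_ es]; rewrite lpa_mulA -(lpa_mulA _ (gh e)) ghost_edge eqxx.
by rewrite gp_vertex // IHs.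
Qed.

Lemma foldl_ep v s x : composable v s -> x ** V v = x ->
  foldl (fun y e => y ** ed e) x s = x ** ep v s.
Proof.
elim: s v x => [|e s IHs] v x /= => [_ -> //|/andP[_ es] _].
by rewrite lpa_mulA (IHs (rng e)) // -lpa_mulA edge_rng.
Qed.

Lemma foldl_gp v s x : composable v s -> V v ** x = x ->
  foldl (fun y e => gh e ** y) x s = gp v s ** x.
Proof.
elim: s v x => [|e s IHs] v x /= => [_ -> //|/andP[_ es] _].
by rewrite -lpa_mulA (IHs (rng e)) // lpa_mulA rng_ghost.
Qed.

Lemma lpa_pathE (p : gpath E) : lpa_path K p = ep (psrc p) (edges p).
Proof.
by rewrite /lpa_path (foldl_ep (valP p)) ?vertex_mul_id // vertex_ep //; exact: valP p.
Qed.

Lemma lpa_path_starE (p : gpath E) : lpa_path_star K p = gp (psrc p) (edges p).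
Proof.
by rewrite /lpa_path_star (foldl_gp (valP p)) ?vertex_mul_id // gp_vertex //; exact: valP p.
Qed.

Lemma edge_ep e v s : rng e != v -> composable v s -> ed e ** ep v s = 0.
Proof.
move=> /negPf ev vs; rewrite -vertex_ep // lpa_mulA edge_vertex ev.
exact: lpa_mul0l.
Qed.

Lemma vertex_ep_neq u v s : u != v -> composable v s -> V u ** ep v s = 0.
Proof.
move=> /negPf uv vs; rewrite -vertex_ep // lpa_mulA vertex_mul uv.
exact: lpa_mul0l.
Qed.

Lemma gp_vertex_neq u v s : v != u -> composable v s -> gp v s ** V u = 0.
Proof.
move=> /negPf uv vs; rewrite -gp_vertex // -lpa_mulA vertex_mul uv.
exact: lpa_mul0r.
Qed.

Definition sink v := forall e, src e <> v.

(** In s* g d* s matching first edges cancel, and a mismatch gives 0. Once g and d are used up, the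
    rest t of s gives t* t = r(t); so the scalar is 0 or 1. *)
Lemma compress_monomial v s u g w d :
  composable v s -> composable u g -> composable w d -> size g = size d ->
  (size g <= size s)%N \/ sink (target v s) ->
  exists k, gp v s ** (ep u g ** gp w d) ** ep v s = k *: V (target v s).
Proof.
have [<-|uv] := eqVneq v u; last first.
  move=> vs ug _ _ _; exists 0; rewrite -(vertex_ep ug) !lpa_mulA.
  by rewrite gp_vertex_neq // !lpa_mul0l scale0r.
have [<-|wv] := eqVneq v w; last first.
  move=> vs _ wd _ _; exists 0; rewrite -(gp_vertex wd) !lpa_mulA.
  by rewrite -(lpa_mulA _ (V w)) vertex_ep_neq 1?eq_sym // lpa_mul0r scale0r.
elim: s v {u w} g d => [|e s IHs] v [|a g] [|b d] // vs;
  try by move=> *; exists 1; rewrite scale1r vertex_mul_id gp_vertex // gp_ep.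
  (* Here s is empty and g is not, so v would be a sink, yet it emits a. *)
  by move=> /andP[/eqP av _] _ _ [//|/(_ a)]; rewrite av.
move=> /= /andP[/eqP av ag] /andP[/eqP bv bd] [gd] gs.
have es : composable (rng e) s by case/andP: vs.
rewrite !lpa_mulA -(lpa_mulA _ (gh e)) ghost_edge.
rewrite -(lpa_mulA _ (gh b)) ghost_edge.
have [ea|_] := eqVneq e a; last first.
  by exists 0; rewrite lpa_mul0r !lpa_mul0l scale0r.
have [be|_] := eqVneq b e; last first.
  by exists 0; rewrite lpa_mul0r !lpa_mul0l scale0r.
rewrite -ea in ag *; rewrite be in bd *; have [|k IH] := IHs (rng e) g d es ag bd gd.
  by case: gs; [left|right].
by exists k; rewrite -IH gp_vertex // -!lpa_mulA vertex_ep.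
Qed.

Definition first_entry_sum H : lpa K E :=
  \sum_(x <- fset_set (first_entries H)) ep x.1 x.2 ** gp x.1 x.2.

(** The sums over sets in [a_class] default to 0 on infinite supports; finiteness turns them into
    sums over lists. *)
Lemma a_classE C : finite_set (first_entries (saturated_closure C)) ->
  a_class K C = first_entry_sum (saturated_closure C).
Proof.
set H := saturated_closure C => fH.
have [finH finF] := (finite_first_entriesP H).1 fH.
rewrite /a_class /first_entry_sum -/H !fsbig_finite //=.
have entriesE : perm_eq (fset_set (first_entries H))
    ([seq (v, [::]) | v <- fset_set H] ++ [seq val p | p <- fset_set (F_E H)]).
  apply: uniq_perm; rewrite ?fset_uniq // ?cat_uniq ?map_inj_uniq ?fset_uniq //=.
  - rewrite andbT; apply/hasPn => _ /mapP[p + ->].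
    rewrite in_fset_set // inE => /F_EP[_ pn].
    by apply/mapP => -[v _ /(congr1 snd)].
  - exact: val_inj.
  - by move=> v w [].
  move=> [v s]; rewrite in_fset_set // mem_cat; apply/idP/orP.
    rewrite inE; case: s => [|e s] vs; [left|right].
      by apply: map_f; rewrite in_fset_set ?inE.
    apply/mapP; exists (exist _ (v, e :: s) (first_entry_composable vs)) => //.
    by rewrite in_fset_set // inE; apply/F_EP.
  rewrite inE => -[] /mapP[].
    by move=> w; rewrite in_fset_set // inE => Hw [-> ->].
  move=> p; rewrite in_fset_set // inE => /F_EP[pH _] /=.
  by case: (p) pH => -[w t] wt /= pH [-> ->].
rewrite [RHS](perm_big _ entriesE) big_cat !big_map; congr (_ + _).
  by apply: eq_bigr => v _; rewrite /= vertex_mul_id.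
by apply: eq_bigr => p _; rewrite lpa_pathE lpa_path_starE.
Qed.

Lemma mem_first_entries H v s : finite_set (first_entries H) ->
  reflect (first_entry H v s) ((v, s) \in fset_set (first_entries H)).
Proof. by move=> fH; rewrite in_fset_set //; apply: (iffP idP); rewrite inE. Qed.

(** Only the path of length 0 at v starts at v, since the longer ones start outside H. *)
Lemma first_entry_sum_vertex H v : finite_set (first_entries H) -> H v ->
  first_entry_sum H ** V v = V v.
Proof.
move=> fH Hv; rewrite lpa_mul_suml (bigD1_seq (v, [::])) ?fset_uniq //=; last first.
  exact/mem_first_entries.
rewrite !vertex_mul_id big_seq_cond big1 ?addr0 // => -[w s] /=.
move=> /andP[/(mem_first_entries _ _ fH) ws nvs].
rewrite -lpa_mulA gp_vertex_neq ?lpa_mul0r //; last exact: first_entry_composable ws.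
by apply: contraNneq nvs => wv; rewrite wv in ws *; rewrite (first_entry_nil Hv ws).
Qed.

Lemma first_entry_sum_vertex0 H v : finite_set (first_entries H) ->
  (forall w, reaches v w -> ~ H w) -> first_entry_sum H ** V v = 0.
Proof.
move=> fH Hv; rewrite lpa_mul_suml big_seq big1 // => -[w s] /=.
move=> /(mem_first_entries _ _ fH) ws; have wsc := first_entry_composable ws.
rewrite -lpa_mulA gp_vertex_neq ?lpa_mul0r //; apply/eqP => wv.
apply: (Hv (target w s)); last exact: first_entry_target.
by apply/reachesP; rewrite -wv; exists s.
Qed.

(** By [central_ghost] it suffices to treat edges. If e starts in H, both products are e. Otherwise
    prepending e matches the indices starting at r(e) with those whose first edge is e. *)
Lemma first_entry_sum_center H : row_finite E -> hereditary H ->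
  finite_set (first_entries H) -> lpa_center K E (first_entry_sum H).
Proof.
move=> rfE hH fH.
have mH v s := mem_first_entries v s fH.
have aV v : first_entry_sum H ** V v = V v ** first_entry_sum H.
  rewrite lpa_mul_suml lpa_mul_sumr big_seq [RHS]big_seq; apply: eq_bigr => -[w s].
  move=> /mH /first_entry_composable ws /=; have [<-|wv] := eqVneq w v.
    by rewrite lpa_mulA vertex_ep // -lpa_mulA gp_vertex.
  by rewrite lpa_mulA vertex_ep_neq 1?eq_sym // -lpa_mulA gp_vertex_neq //
    lpa_mul0l lpa_mul0r.
suff ae e : first_entry_sum H ** ed e = ed e ** first_entry_sum H.
  by apply: central_ext => //; exact: central_ghost.
have [He|He] := pselect (H (src e)).
  rewrite -src_edge lpa_mulA first_entry_sum_vertex //.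
  rewrite src_edge -[ed e in RHS]edge_rng -lpa_mulA -aV.
  by rewrite first_entry_sum_vertex ?edge_rng //; exact: hH.
pose starts (x : vertex E * seq (edge E)) := ohead x.2 == Some e.
rewrite lpa_mul_suml lpa_mul_sumr.
rewrite [RHS](bigID (fun x : vertex E * seq (edge E) => x.1 == rng e)) /=.
rewrite [X in _ = _ + X]big1_seq ?addr0 /=; last first.
  move=> [w s] /andP[/= wne /mH /first_entry_composable ws].
  by rewrite lpa_mulA edge_ep ?lpa_mul0l // eq_sym.
(* A path with first edge f other than e is killed by f* e = 0, and a vertex of H by s(e) not being
   in H. *)
rewrite (bigID starts) /= [X in _ + X]big1_seq ?addr0 /=; last first.
  move=> [w [|f s]] /andP[/= sf /mH /= ws].
    by rewrite vertex_mul_id vertex_edge; case: eqP => // we; case: He; rewrite -we.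
  by rewrite -!lpa_mulA ghost_edge (negPf (sf : f != e)) !lpa_mul0r.
rewrite -big_filter -[RHS]big_filter.
set r := filter _ _; set r' := filter _ _.
have rE : perm_eq r [seq (src e, e :: x.2) | x : vertex E * seq (edge E) <- r'].
  apply: uniq_perm; rewrite ?filter_uniq ?fset_uniq //.
    rewrite map_inj_in_uniq ?filter_uniq ?fset_uniq // => -[v s] [w t].
    by rewrite !mem_filter /= => /andP[/eqP -> _] /andP[/eqP -> _] [->].
  move=> [v s]; rewrite mem_filter /starts /=; apply/andP/mapP.
    case: s => [|f s] [] //= /eqP[->] /mH /= [fv Hv fs].
    exists (rng e, s); last by rewrite fv.
    by rewrite mem_filter eqxx; apply/mH.
  move=> [[w t]]; rewrite mem_filter /= => /andP[/eqP -> /mH et] [-> ->].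
  by rewrite eqxx; split=> //; apply/mH.
rewrite (perm_big _ rE) big_map big_seq [RHS]big_seq; apply: eq_bigr => -[v s].
rewrite mem_filter /= => /andP[/eqP -> /mH /first_entry_composable es].
by rewrite -!lpa_mulA ghost_edge eqxx gp_vertex.
Qed.

End Paths.

(** * Closure properties of linear spans *)

Section Span.
Variables (K : fieldType) (W : lmodType K) (S : set W).

Lemma lspan0 : lspan S 0.
Proof.
exists 0%N, (fun=> 0), (fun=> 0); split; first by case.
by rewrite big_ord0.
Qed.

Lemma lspanD x y : lspan S x -> lspan S y -> lspan S (x + y).
Proof.
move=> [n [k [b [Sb ->]]]] [m [l [c [Sc ->]]]].
exists (n + m)%N.
exists (fun i => match fintype.split i with inl j => k j | inr j => l j end).
exists (fun i => match fintype.split i with inl j => b j | inr j => c j end).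
split=> [i|]; first by case: fintype.split.
rewrite big_split_ord; congr (_ + _); apply: eq_bigr => i _.
  by rewrite -[lshift _ _]/(unsplit (inl i)) unsplitK.
by rewrite -[rshift _ _]/(unsplit (inr i)) unsplitK.
Qed.

Lemma lspanZ a x : lspan S x -> lspan S (a *: x).
Proof.
move=> [n [k [b [Sb ->]]]]; exists n, (fun i => a * k i), b; split=> //.
by rewrite scaler_sumr; apply: eq_bigr => i _; rewrite scalerA.
Qed.

Lemma lspan_mem x : S x -> lspan S x.
Proof.
move=> Sx; exists 1%N, (fun=> 1), (fun=> x); split=> //.
by rewrite big_ord1 scale1r.
Qed.

Lemma lspan_closed (Q : W -> Prop) :
  Q 0 -> (forall x y, Q x -> Q y -> Q (x + y)) -> (forall a x, Q x -> Q (a *: x)) ->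
  (forall x, S x -> Q x) -> forall x, lspan S x -> Q x.
Proof.
by move=> Q0 QD QZ QS x [n [k [b [Sb ->]]]]; apply: big_ind => // i _; apply/QZ/QS.
Qed.

End Span.

(** * Central elements of degree 0 and their eigenvertices *)

Section Center.
Variables (K : fieldType) (E : digraph).
Implicit Types (x y z : lpa K E) (k : K).
Implicit Types (u v w : vertex E) (e f : edge E) (s t : seq (edge E)).
Implicit Types (C : set (vertex E)).
Hypothesis rfE : row_finite E.

Notation V v := (lpa_vertex K v).
Notation ed e := (lpa_edge K e).
Notation gh e := (lpa_ghost K e).

(** For a monomial, N is the common length of its path and ghost path; for a sum, the larger bound
    serves. *)
Lemma homog0_compress z : lpa_homog K E 0 z ->
  exists N, forall v s, composable v s -> (N <= size s)%N \/ sink (target v s) ->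
    exists k, gp K v s ** z ** ep K v s = k *: V (target v s).
Proof.
move: z; apply: lspan_closed.
- by exists 0%N => v s _ _; exists 0; rewrite lpa_mul0r lpa_mul0l scale0r.
- move=> x y [N xN] [M yM]; exists (maxn N M) => v s vs NM.
  have [|k xk] := xN v s vs.
    by case: NM => ?; [left; apply: leq_trans (leq_maxl N M) _|right].
  have [|l yl] := yM v s vs.
    by case: NM => ?; [left; apply: leq_trans (leq_maxr N M) _|right].
  by exists (k + l); rewrite lpa_mulDr lpa_mulDl xk yl scalerDl.
- move=> a x [N xN]; exists N => v s vs /(xN v s vs)[k xk].
  by exists (a * k); rewrite lpa_mulZr lpa_mulZl xk scalerA.
move=> _ [p [p' [pp' ->]]]; exists (plength p) => v s vs Ns.
rewrite lpa_pathE lpa_path_starE; apply: compress_monomial => //.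
- exact: valP p.
- exact: valP p'.
by move/eqP: pp'; rewrite subr_eq0 => /eqP[].
Qed.

(** Allowing every larger list lets one list serve both terms of a sum. *)
Lemma homog_local_unit n z : lpa_homog K E n z ->
  exists l : seq (vertex E), forall l', uniq l' -> {subset l <= l'} ->
    z ** \sum_(v <- l') V v = z.
Proof.
move: z; apply: lspan_closed.
- by exists [::] => l' _ _; rewrite lpa_mul0l.
- move=> x y [l xl] [m ym]; exists (l ++ m) => l' ul' sl'.
  rewrite lpa_mulDl xl ?ym // => v vl; apply: sl'; rewrite mem_cat vl //.
  by rewrite orbT.
- by move=> a x [l xl]; exists l => l' ul' sl'; rewrite lpa_mulZl xl.
move=> _ [p [p' [_ ->]]]; exists [:: psrc p'] => l' ul' sl'.
have p'l' : psrc p' \in l' by rewrite sl' ?mem_head.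
have vp' := valP p'; rewrite lpa_pathE lpa_path_starE lpa_mul_sumr.
rewrite (bigD1_seq (psrc p')) //=.
rewrite -lpa_mulA gp_vertex // big1 ?addr0 // => v vp.
by rewrite -lpa_mulA gp_vertex_neq ?lpa_mul0r // eq_sym.
Qed.

Lemma homog_support n z : lpa_homog K E n z -> exists l : seq (vertex E),
  (forall v, v \notin l -> z ** V v = 0) /\ ((forall v, z ** V v = 0) -> z = 0).
Proof.
move=> /homog_local_unit[l zl]; have := zl (undup l) (undup_uniq _) _.
have /[swap]/[apply] lz : {subset l <= undup l} by move=> v; rewrite mem_undup.
exists l; split=> [v vl|zV].
  rewrite -lz -lpa_mulA lpa_mul_suml big1_seq ?lpa_mul0r // => w /andP[_].
  rewrite mem_undup => wl; rewrite vertex_mul; case: eqP => // wv.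
  by rewrite wv (negPf vl) in wl.
by rewrite -lz lpa_mul_sumr big1.
Qed.

(** These are the sets H_k. *)
Definition eigenvertices z k : set (vertex E) := [set v | z ** V v = k *: V v].

Lemma eigenvertices_inj z k k' v :
  eigenvertices z k v -> eigenvertices z k' v -> k = k'.
Proof.
rewrite /eigenvertices /= => -> /eqP; rewrite -subr_eq0 -scalerBl.
move=> /eqP /(vertex_scale_eq0 rfE) /eqP.
by rewrite subr_eq0 => /eqP.
Qed.

Section CentralElement.
Variable z : lpa K E.
Hypothesis zc : lpa_center K E z.

(** z r(e) = z e* e = e* z s(e) e. *)
Lemma eigenvertices_hereditary k : hereditary (eigenvertices z k).
Proof.
rewrite /eigenvertices => e /= ze.
have ee : gh e ** ed e = V (rng e) by rewrite ghost_edge eqxx.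
rewrite -[in LHS]ee lpa_mulA zc -lpa_mulA -[ed e]src_edge (lpa_mulA z) ze.
by rewrite lpa_mulZl lpa_mulZr src_edge ee.
Qed.

(** v is the sum of the e e*, and z e e* = e z r(e) e* = k e e*. *)
Lemma eigenvertices_saturated k : saturated (eigenvertices z k).
Proof.
rewrite /eigenvertices => v rv zr /=; rewrite (vertex_CK2 K rv) lpa_mul_sumr scaler_sumr.
rewrite big_seq [RHS]big_seq; apply: eq_bigr => e; rewrite mem_emitted // => /eqP ev.
rewrite lpa_mulA zc -[ed e in LHS]edge_rng -(lpa_mulA _ _ z) -zc zr //.
by rewrite lpa_mulZr lpa_mulZl edge_rng.
Qed.

Lemma eigenvertices_reaches k v w :
  reaches v w -> eigenvertices z k v -> eigenvertices z k w.
Proof. by apply: hereditary_reaches; exact: eigenvertices_hereditary. Qed.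

Lemma reaches_neq0 v w : reaches v w -> z ** V w <> 0 -> z ** V v <> 0.
Proof.
move=> vw zw zv; apply: zw; rewrite -(scale0r (V w)).
by apply: eigenvertices_reaches vw _; rewrite /eigenvertices /= scale0r.
Qed.

Hypothesis zh : lpa_homog K E 0 z.

(** Centrality turns s* z s into z s* s = z r(s). *)
Lemma eigenvertices_target : exists N, forall v s, composable v s ->
  (N <= size s)%N \/ sink (target v s) -> exists k, eigenvertices z k (target v s).
Proof.
have [N zN] := homog0_compress zh; exists N => v s vs Ns.
have [k] := zN v s vs Ns; rewrite -zc -lpa_mulA gp_ep // => zk.
by exists k.
Qed.

Lemma closed_at_eigenvertex v : closed_at v -> exists k, eigenvertices z k v.
Proof.
move=> cv; have [N zN] := eigenvertices_target.
have [s [vs sv Ns]] := closed_at_long N cv.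
by rewrite -sv; apply: zN => //; left.
Qed.

(** Where T contains no bifurcations, saturation carries H_k backwards along a path, each vertex on
    the way emitting a single edge. For a cycle leading to v and w, its vertex u lies in some H_l,
    and heredity towards v forces l = k. *)
Lemma eigenvertices_sim k v w : sim v w -> eigenvertices z k v -> eigenvertices z k w.
Proof.
apply: sim_invariant => {}v {}w [-> //|[vw nb]|[c [u [cc cu uv uw]]]] zv.
  case: vw => [|vw]; last exact: eigenvertices_reaches vw zv.
  have Tw u : reaches w u -> ~ bifurcation u by move=> wu; apply: nb; right.
  move=> wv; move: w wv {nb} Tw; apply: (reaches_ind_r (w := v)) => // e ev IH Te.
  apply: eigenvertices_saturated => [|f fe].
    by split; [exact: rfE|exists e].
  have -> : f = e.
    by apply: contrapT => ef; apply: (Te _ (reaches_refl _)); exists f, e.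
  by apply: IH => u eu; apply: Te; apply: reaches_trans eu; exact: reaches_edge.
have [l zu] := closed_at_eigenvertex (cycle_closed_at cc cu).
have kl := eigenvertices_inj zv (eigenvertices_reaches uv zu).
by rewrite kl; exact: eigenvertices_reaches uw zu.
Qed.

(** By saturation of H_0, a vertex not killed by z is a sink or emits an edge whose range is not
    killed either. *)
Lemma central_long_path n v : z ** V v <> 0 -> exists s,
  [/\ composable v s, (n <= size s)%N \/ sink (target v s) & z ** V (target v s) <> 0].
Proof.
elim: n v => [|n IHn] v zv; first by exists [::]; split=> //; left.
have [sv|/existsNP[e0 /contrapT e0v]] := pselect (sink v).
  by exists [::]; split=> //; right.
have [e [ev ze]] : exists e, src e = v /\ z ** V (rng e) <> 0.
  apply: contrapT => Ne; apply: zv; rewrite -(scale0r (V v)).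
  apply: eigenvertices_saturated => [|e ev].
    by split; [exact: rfE|exists e0].
  by rewrite /eigenvertices /= scale0r; apply: contrapT => ze; apply: Ne; exists e.
have [s [es ns zs]] := IHn _ ze; exists (e :: s); split=> //=.
by rewrite ev eqxx.
Qed.

Lemma central_meets_P : z <> 0 ->
  exists v k, [/\ P v, k <> 0 & eigenvertices z k v].
Proof.
move=> z0; have [l [zl zV]] := homog_support zh.
have [v zv] : exists v, z ** V v <> 0.
  by apply: contrapT => Nz; apply/z0/zV => v; apply: contrapT => zv; apply: Nz; exists v.
have [N zN] := eigenvertices_target.
have [s [vs Ns zs]] := central_long_path N zv.
have [k kw] := zN v s vs Ns.
have k0 : k <> 0 by move=> k0; apply: zs; rewrite kw k0 scale0r.
have [|||w [kw' Pw]] := @finite_hereditary_meets_P E l (eigenvertices z k).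
- exact: eigenvertices_hereditary.
- move=> w zw; apply: contrapT => /negP /zl; rewrite zw.
  by move=> /(vertex_scale_eq0 rfE).
- by exists (target v s).
by exists w, k.
Qed.

(** The sources of the edges of an entering path lie in the support l of z and do not repeat, which
    bounds its length by the size of l. *)
Lemma eigenvertex_X_f k v : k <> 0 -> P v -> eigenvertices z k v ->
  X_f (sim_class v).
Proof.
move=> k0 Pv zv; set H := saturated_closure (sim_class v).
have [l [zl _]] := homog_support zh.
have lz w : z ** V w <> 0 -> w \in l.
  by move=> zw; apply: contrapT => /negP /zl.
have Hz : H `<=` eigenvertices z k.
  apply: closure_min; first exact: eigenvertices_saturated.
  by move=> w vw; exact: eigenvertices_sim vw zv.
have Hz0 w u : reaches w u -> H u -> z ** V w <> 0.
  move=> wu /Hz zu; apply: (reaches_neq0 wu); rewrite zu.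
  by move=> /(vertex_scale_eq0 rfE).
have [finH finF] : finite_set H /\ finite_set (F_E H).
  apply/finite_first_entriesP/(@finite_first_entries _ _ l (size l)) => // w s ws.
  have wsc := first_entry_composable ws; have Hs := first_entry_target ws.
  split; first by apply: lz; apply: Hz0 Hs; apply/reachesP; exists s.
  rewrite -(size_map (@src E)); apply: uniq_leq_size => [|_ /mapP[e es ->]].
    (* A repeated source lies on a closed path and leads into [v], so it belongs to [v]; but the
       path has not yet entered the closure there. *)
    apply: contrapT => /negP /(repeated_closed_at wsc)[e es ce].
    have [_ er] := mem_path_reaches wsc es.
    have [u vu su] := closure_reaches Hs.
    have eu := reaches_trans (reaches_edge e) (reaches_trans er su).
    apply: (first_entry_mem ws es); apply: closure_sub.
    exact: sim_trans vu (sim_sym (closed_at_sim ce eu)).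
  have [_ er] := mem_path_reaches wsc es.
  by apply: lz; apply: Hz0 Hs; exact: reaches_trans (reaches_edge e) er.
split=> [|u vu Pu]; first by exists v.
have uv := sim_class_eq (sim_refl u) vu.
by split=> //; rewrite uv.
Qed.

End CentralElement.

(** * The elements a_[v] as a basis *)

Lemma X_f_finite v : P v -> X_f (sim_class v) ->
  finite_set (first_entries (saturated_closure (sim_class v))).
Proof. by move=> Pv [_ /(_ v (sim_refl v) Pv)[_ ? ?]]; apply/finite_first_entriesP. Qed.

Lemma a_class_vertex v u : P v -> X_f (sim_class v) -> sim_class v u ->
  a_class K (sim_class v) ** V u = V u.
Proof.
move=> Pv /(X_f_finite Pv) fv vu; rewrite a_classE // first_entry_sum_vertex //.
exact: closure_sub.
Qed.

Lemma a_class_vertex0 v u : P v -> X_f (sim_class v) -> P u ->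
  sim_class v <> sim_class u -> a_class K (sim_class v) ** V u = 0.
Proof.
move=> Pv /(X_f_finite Pv) fv Pu vu; rewrite a_classE // first_entry_sum_vertex0 //.
move=> w uw vw; apply: vu.
exact: (sim_class_closure_disjoint Pv Pu (sim_refl u) uw vw).
Qed.

Lemma a_class_center_homog C : X_f C -> lpa_center_homog K E 0 (a_class K C).
Proof.
move=> XC; have [[v Pv vC] _] := XC; move: XC; rewrite -vC => /(X_f_finite Pv) fv.
rewrite a_classE //; split.
  apply: first_entry_sum_center => //.
  by apply: closure_hereditary; exact: sim_class_hereditary.
rewrite /first_entry_sum big_seq; apply: big_ind => [|x y|[w s]].
- exact: lspan0.
- exact: lspanD.
move=> /(mem_first_entries _ _ fv) /first_entry_composable ws; apply: lspan_mem.
exists (exist _ (w, s) ws), (exist _ (w, s) ws); rewrite subrr; split=> //.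
by rewrite lpa_pathE lpa_path_starE.
Qed.

Lemma center_homogD x y : lpa_center_homog K E 0 x -> lpa_center_homog K E 0 y ->
  lpa_center_homog K E 0 (x + y).
Proof.
move=> [xc xh] [yc yh]; split; last exact: lspanD.
by move=> t; rewrite lpa_mulDl lpa_mulDr xc yc.
Qed.

Lemma center_homogZ k x : lpa_center_homog K E 0 x ->
  lpa_center_homog K E 0 (k *: x).
Proof.
move=> [xc xh]; split; last exact: lspanZ.
by move=> t; rewrite lpa_mulZl lpa_mulZr xc.
Qed.

(** Induction on a list containing the vertices of [P] on which z acts by a nonzero scalar. *)
Lemma center_homog_span (l : seq (vertex E)) z : lpa_center_homog K E 0 z ->
  (forall v k, P v -> k <> 0 -> eigenvertices z k v -> v \in l) ->
  lspan (B_0 K E) z.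
Proof.
elim: l z => [|v l IHl] z zch zl.
  have [->|z0] := pselect (z = 0); first exact: lspan0.
  have [zc zh] := zch; have [v [k [Pv k0 zv]]] := central_meets_P zc zh z0.
  by have := zl v k Pv k0 zv.
have [zc zh] := zch.
have [[k [Pv k0 zv]]|Nv] := pselect (exists k, [/\ P v, k <> 0 & eigenvertices z k v]);
    last first.
  apply: IHl => // w k Pw k0 zw; have := zl w k Pw k0 zw; rewrite inE => /orP[] //.
  by move=> /eqP wv; case: Nv; exists k; rewrite -wv.
have Xv := eigenvertex_X_f zc zh k0 Pv zv.
rewrite -(subrK (k *: a_class K (sim_class v)) z) -scaleNr; apply: lspanD; last first.
  by apply: lspanZ; apply: lspan_mem; exists (sim_class v).
apply: IHl => [|w k' Pw k'0 zw].
  exact/center_homogD/center_homogZ/a_class_center_homog.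
move: zw; rewrite /eigenvertices /= lpa_mulDl lpa_mulZl.
(* On [v] the difference acts as k - k = 0; on the other vertices of [P] it acts as z does. *)
have [vw|vw] := pselect (sim v w).
  rewrite a_class_vertex // (eigenvertices_sim zc zh vw zv) -scalerDl subrr scale0r.
  by move=> /esym /(vertex_scale_eq0 rfE).
rewrite a_class_vertex0 // => [|vwE]; last first.
  by apply: vw; rewrite -[sim v w]/(sim_class v w) vwE; exact: sim_refl.
rewrite scaler0 addr0 => /(zl w k' Pw k'0); rewrite inE => /orP[/eqP wv|] //.
by case: vw; rewrite wv; exact: sim_refl.
Qed.

(** Multiplying the relation by a vertex v of [P] in the i-th class leaves only k_i v. *)
Lemma B_0_independent : linearly_independent (B_0 K E).
Proof.
move=> n k b bi bB sum0 i.
have [C XC Cb] := bB i; have [[v Pv vC] _] := XC.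
rewrite -{}vC in XC Cb; apply: (vertex_scale_eq0 rfE (v := v)).
have := congr1 (fun x => x ** V v) sum0.
rewrite lpa_mul0l lpa_mul_suml (bigD1 i) //= lpa_mulZl -Cb a_class_vertex //;
  last exact: sim_refl.
rewrite big1 ?addr0 // => j ji; rewrite lpa_mulZl.
have [C' XC' Cb'] := bB j; have [[v' Pv' vC'] _] := XC'.
rewrite -{}vC' in XC' Cb'; rewrite -Cb' a_class_vertex0 ?scaler0 // => vv'.
(* Equal classes would give equal members of the family b, against its injectivity. *)
by move: ji; rewrite (bi j i) ?eqxx // -Cb -Cb' vv'.
Qed.

End Center.

Theorem theorem3p18 (E : digraph) (K : fieldType) :
  row_finite E -> is_basis (B_0 K E) (lpa_center_homog K E 0%R).
Proof.
move=> rfE; split; first exact: B_0_independent.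
apply/seteqP; split=> z.
  move: z; apply: lspan_closed => [|x y|k x|_ [C XC <-]].
  - by split=> [x|]; [rewrite lpa_mul0l lpa_mul0r|exact: lspan0].
  - exact: center_homogD.
  - exact: center_homogZ.
  - exact: a_class_center_homog.
move=> zch; have [l [zl _]] := homog_support zch.2.
(* The finite support of z serves as the initial list. *)
apply: (center_homog_span rfE (l := l)) => // v k Pv k0 zv.
by apply: contrapT => /negP /zl; rewrite zv => /(vertex_scale_eq0 rfE).
Qed.
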